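(* Termination of triangular affine integer loops is decidable if and only if termination of nnt-loops is decidable.
   Context: An affine integer loop is $\textbf{while } \phi \textbf{ do } \mathbf{x}\leftarrow A\mathbf{x}+\mathbf{a}$, where $A\in\mathbb{Z}^{d\times d}$ ($d\ge1$), $\mathbf{x}$ is a column vector of pairwise different variables $x_1,\dots,x_d$, $\mathbf{a}\in\mathbb{Z}^d$, and $\phi$ is a conjunction of inequalities $\alpha>0$ with $\alpha$ an affine expression with rational coefficients over $\mathbf{x}$. With $f(\mathbf{x})=A\mathbf{x}+\mathbf{a}$, the loop is non-terminating if there exists $\mathbf{c}\in\mathbb{Z}^d$ such that $\phi[\mathbf{x}/f^n(\mathbf{c})]$ holds for all $n\in\mathbb{N}$; otherwise it terminates. The loop is triangular if $A$ is triangular (upper or lower), and an nnt-loop if it is triangular and all diagonal entries of $A$ are non-negative. *)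

(* Defs.v *)
From mathcomp Require Import all_boot all_order all_algebra.

Set Implicit Arguments.
Unset Strict Implicit.
Unset Printing Implicit Defensive.

Import Order.TTheory GRing.Theory Num.Theory.

(* Kleene's partial recursive functions. Arities are not tracked: an argument  *)
(* list that is too short is read as padded with zeros by [Succ] and [Proj],   *)
(* and leaves [Prec] undefined. On inputs of a fixed length the terms denote   *)
(* exactly the usual partial recursive functions of that arity.                *)
Inductive recfun : Type :=
  | Zero
  | Succ
  | Proj of nat
  | Comp of recfun & seq recfun
  | Prec of recfun & recfun
  | Mu of recfun.

(* [eval e v y]: the computation of e on the arguments v halts with value y.   *)
Inductive eval : recfun -> seq nat -> nat -> Prop :=
  | eval_zero v : eval Zero v 0
  | eval_succ v : eval Succ v (nth 0 v 0).+1
  | eval_proj i v : eval (Proj i) v (nth 0 v i)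
  | eval_comp f gs v w y : evals gs v w -> eval f w y -> eval (Comp f gs) v y
  | eval_prec0 f g v y : eval f v y -> eval (Prec f g) (0 :: v) y
  | eval_precS f g n v r y :
      eval (Prec f g) (n :: v) r -> eval g [:: n, r & v] y ->
      eval (Prec f g) (n.+1 :: v) y
  | eval_mu f v n :
      eval f (n :: v) 0 ->
      (forall i, i < n -> exists k, eval f (i :: v) k.+1) ->
      eval (Mu f) v n
with evals : seq recfun -> seq nat -> seq nat -> Prop :=
  | evals_nil v : evals [::] v [::]
  | evals_cons g gs v y w :
      eval g v y -> evals gs v w -> evals (g :: gs) v (y :: w).

(* Decidability of P for instances taken from the class C: nothing is required *)
(* of the algorithm on numbers that do not encode an element of C.             *)
Definition decidable_on (T : Type) (code : T -> nat) (C P : T -> Prop) : Prop :=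
  exists e : recfun, forall x : T, C x ->
    (P x -> eval e [:: code x] 1) /\ (~ P x -> eval e [:: code x] 0).

Local Open Scope ring_scope.

(* (b, c) stands for the affine expression b x + c.                            *)
Definition affine_expr (d : nat) : Type := ('rV[rat]_d * rat)%type.

Definition affine_val (d : nat) (alpha : affine_expr d) (c : 'cV[int]_d) : rat :=
  (alpha.1 *m map_mx intr c) 0 0 + alpha.2.

(* The guard is the conjunction of alpha > 0 for alpha in [guard].             *)
Record affine_loop : Type := AffineLoop {
  dim : nat;
  dim_gt0 : (0 < dim)%N;
  guard : seq (affine_expr dim);
  update_mx : 'M[int]_dim;
  update_cst : 'cV[int]_dim
}.

Definition update (L : affine_loop) (x : 'cV[int]_(dim L)) : 'cV[int]_(dim L) :=
  update_mx L *m x + update_cst L.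

Definition guard_holds (L : affine_loop) (c : 'cV[int]_(dim L)) : bool :=
  all (fun alpha => 0 < affine_val alpha c) (guard L).

Definition nonterminating (L : affine_loop) : Prop :=
  exists c : 'cV[int]_(dim L), forall n : nat, guard_holds (iter n (@update L) c).

Definition terminating (L : affine_loop) : Prop := ~ nonterminating L.

(* [is_trig_mx] is lower triangularity.                                        *)
Definition triangular (L : affine_loop) : Prop :=
  is_trig_mx (update_mx L) \/ is_trig_mx (update_mx L)^T.

Definition nnt (L : affine_loop) : Prop :=
  triangular L /\ forall i : 'I_(dim L), 0 <= update_mx L i i.

Definition code_int (z : int) : nat :=
  match z with Posz n => n.*2 | Negz n => n.*2.+1 end.

Definition code_rat (q : rat) : nat :=
  CodeSeq.code [:: code_int (numq q); code_int (denq q)].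

(* [CodeSeq.code] is a bijection from seq nat to nat.                          *)
Definition code_vec (n : nat) (f : 'I_n -> nat) : nat :=
  CodeSeq.code [seq f i | i <- enum 'I_n].

Definition code_expr (d : nat) (alpha : affine_expr d) : nat :=
  CodeSeq.code [:: code_vec (fun j => code_rat (alpha.1 0 j)); code_rat alpha.2].

Definition code_loop (L : affine_loop) : nat :=
  CodeSeq.code
    [:: dim L;
        CodeSeq.code [seq code_expr alpha | alpha <- guard L];
        code_vec (fun i => code_vec (fun j => code_int (update_mx L i j)));
        code_vec (fun i => code_int (update_cst L i 0))].

Definition termination_decidable (C : affine_loop -> Prop) : Prop :=
  decidable_on code_loop C terminating.

(* Main.v *)
(* The loop that performs two steps of a triangular loop L per iteration, with *)

(* Every nnt-loop is triangular, so in one direction the same program serves. For the other, a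
   triangular [A] has a triangular square whose diagonal entries are squares, so [square L] is an
   nnt-loop ([nnt_square]). Started at [c], the loop [square L] tests the states that [L] visits
   from [c], two per iteration; hence [c] is a witness of non-termination for one loop exactly if it
   is for the other ([nonterminating_square]).

   It remains to see that one program sends the code of [L] to the code of [square L]. The function
   [code_square] describes this map on numbers, [computable_code_square] obtains a program for it
   from closure properties of [computable], and [code_squareE] identifies it with [square] on codes
   of loops. Composing this program with a decision procedure for nnt-loops decides triangular
   loops. Scaling each new guard atom by its positive [common_den] preserves its sign and makes its
   coefficients integers, so no fraction has to be reduced. *)
(* guard phi(x) /\ phi(f(x)), terminates iff L does, and it is an nnt-loop     *)
(* because the diagonal of A^2 consists of the squares of the diagonal entries *)
(* of A. So a decision procedure for nnt-loops decides triangular loops once   *)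
(* L |-> L^2 is shown to be computable on codes, by a program in Kleene's      *)
(* calculus. The new guard atoms are scaled by a common denominator, which     *)
(* leaves only integer sums and products to be computed.                       *)
From mathcomp Require Import all_boot all_order all_algebra.
Require Import Defs.

Set Implicit Arguments.
Unset Strict Implicit.
Unset Printing Implicit Defensive.

Import Order.TTheory GRing.Theory Num.Theory.

(** * Computability in a context: substitution and primitive recursion *)

(* [ctx] plays the role of a typing context: its entries are the quantities    *)
(* depending on [x : E] that a program computing [F x] gets as arguments;      *)
(* [bind] extends it by a fresh variable ranging over nat.                     *)
Definition computable (E : Type) (ctx : seq (E -> nat)) (F : E -> nat) : Prop :=
  exists e, forall x, eval e [seq c x | c <- ctx] (F x).

Definition bind (E : Type) (ctx : seq (E -> nat)) : seq (nat * E -> nat) :=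
  fst :: [seq (fun p => c p.2) | c <- ctx].

Lemma map_bind (E : Type) (ctx : seq (E -> nat)) (p : nat * E) :
  [seq c p | c <- bind ctx] = p.1 :: [seq c p.2 | c <- ctx].
Proof. by rewrite /= -map_comp. Qed.

Lemma eq_computable (E : Type) (ctx : seq (E -> nat)) (F G : E -> nat) :
  F =1 G -> computable ctx F -> computable ctx G.
Proof. by move=> FG [e eP]; exists e => x; rewrite -FG. Qed.

Lemma computable_nth (E : Type) (ctx : seq (E -> nat)) (i : nat) :
  computable ctx (fun x => nth 0 [seq c x | c <- ctx] i).
Proof. by exists (Proj i) => x; exact: eval_proj. Qed.

(** Indices [i] replace membership in a list of functions; past the end of [ctx] the entry is the
    constant 0, so the condition there is harmless. *)
Lemma computable_evals (E E' : Type) (ctx : seq (E -> nat))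
    (ctx' : seq (E' -> nat)) (g : E' -> E) :
  (forall i, computable ctx' (fun y => nth 0 [seq c (g y) | c <- ctx] i)) ->
  exists es, forall y, evals es [seq c y | c <- ctx'] [seq c (g y) | c <- ctx].
Proof.
elim: ctx => [|c ctx IH] cg; first by exists [::] => y; exact: evals_nil.
have [e eP] := cg 0; have [es esP] := IH (fun i => cg i.+1).
by exists (e :: es) => y; apply: evals_cons (eP y) (esP y).
Qed.

Lemma computable_subst (E E' : Type) (ctx : seq (E -> nat))
    (ctx' : seq (E' -> nat)) (g : E' -> E) (F : E -> nat) :
  (forall i, computable ctx' (fun y => nth 0 [seq c (g y) | c <- ctx] i)) ->
  computable ctx F -> computable ctx' (fun y => F (g y)).
Proof.
move=> /computable_evals[es esP] [e eP].
by exists (Comp e es) => y; apply: eval_comp (esP y) (eP (g y)).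
Qed.

Lemma computable_var (E : Type) (ctx : seq (E -> nat)) :
  computable (bind ctx) fst.
Proof. exact: computable_nth (bind ctx) 0. Qed.

Lemma computable_weaken (E : Type) (ctx : seq (E -> nat)) (F : E -> nat) :
  computable ctx F -> computable (bind ctx) (fun p => F p.2).
Proof.
apply: computable_subst => i; apply: eq_computable (computable_nth _ i.+1) => p.
by rewrite map_bind.
Qed.

(** Inserts a variable just below the innermost one. It is needed when the body of a recursion reads
    the counter but not the accumulator that follows it. *)
Lemma computable_weaken_under (E : Type) (ctx : seq (E -> nat))
    (F : nat * E -> nat) :
  computable (bind ctx) F ->
  computable (bind (bind ctx)) (fun p => F (p.1, p.2.2)).
Proof.
apply: (computable_subst (g := fun p => (p.1, p.2.2))) => -[|i].
  exact: computable_var.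
apply: eq_computable (computable_nth _ i.+2) => p.
by rewrite !map_bind.
Qed.

Lemma computable_let (E : Type) (ctx : seq (E -> nat)) (M : E -> nat)
    (F : nat * E -> nat) :
  computable ctx M -> computable (bind ctx) F ->
  computable ctx (fun x => F (M x, x)).
Proof.
move=> cM; apply: (computable_subst (g := fun x => (M x, x))) => -[|i] //.
by apply: eq_computable (computable_nth ctx i) => x; rewrite map_bind.
Qed.

Lemma computable_id (E : Type) (c : E -> nat) : computable [:: c] c.
Proof. exact: computable_nth [:: c] 0. Qed.

Lemma computable_succ (E : Type) (ctx : seq (E -> nat)) (F : E -> nat) :
  computable ctx F -> computable ctx (fun x => (F x).+1).
Proof.
case=> e eP; exists (Comp Succ [:: e]) => x.
apply: eval_comp (eval_succ [:: F x]).
by apply: evals_cons (eP x) _; exact: evals_nil.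
Qed.

Lemma computable_const (E : Type) (ctx : seq (E -> nat)) (n : nat) :
  computable ctx (fun=> n).
Proof.
elim: n => [|n]; first by exists Zero => x; exact: eval_zero.
exact: computable_succ.
Qed.

(** The step program of [Prec] receives the counter, the previous value and then the parameters,
    which is the layout of [bind (bind ctx)]. Projections recopy the parameters after the bound
    [N x]. *)
Lemma computable_rec (E : Type) (ctx : seq (E -> nat)) (N F : E -> nat)
    (G : nat -> nat -> E -> nat) :
  computable ctx N -> computable ctx F ->
  computable (bind (bind ctx)) (fun p => G p.1 p.2.1 p.2.2) ->
  computable ctx
    (fun x => nat_rect (fun=> nat) (F x) (fun m r => G m r x) (N x)).
Proof.
move=> [eN NP] [eF FP] [eG GP].
have [es esP] := computable_evals (g := id) (computable_nth ctx).
exists (Comp (Prec eF eG) (eN :: es)) => x.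
apply: eval_comp (evals_cons (NP x) (esP x)) _.
elim: (N x) => [|n IH] /=; first exact: eval_prec0.
apply: eval_precS IH _; move: (nat_rect _ _ _ n) => r.
by have := GP (n, (r, x)); rewrite !map_bind.
Qed.

(* Fails when the innermost variable is used: [H] must be a constant function. *)
Ltac weaken :=
  match goal with
  | |- @computable _ (@bind ?E ?ctx) ?F =>
      let H := eval cbn beta iota delta [fst snd] in
        (fun (m : nat) (y : E) => F (m, y)) in
      match H with
      | fun _ => ?F' => refine (@computable_weaken E ctx F' _)
      end
  end.

Ltac base :=
  first
  [ assumption
  | lazymatch goal with
    | |- computable _ (fun _ => ?n) => exact: computable_const
    | |- computable _ (fun p => fst p) => exact: computable_var
    | |- computable _ fst => exact: computable_var
    | |- computable _ (fun x => x) => exact: computable_id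
    | |- _ => weaken; base
    end ].

(** * Arithmetic and Boolean tests on natural numbers *)

Lemma computable_pred (E : Type) (ctx : seq (E -> nat)) (F : E -> nat) :
  computable ctx F -> computable ctx (fun x => (F x).-1).
Proof.
move=> cF; apply: eq_computable (computable_rec (F := fun=> 0)
  (G := fun m _ _ => m) cF _ _); try base.
by move=> x; case: (F x).
Qed.

Lemma computable_add (E : Type) (ctx : seq (E -> nat)) (F G : E -> nat) :
  computable ctx F -> computable ctx G -> computable ctx (fun x => F x + G x).
Proof.
move=> cF cG.
apply: eq_computable (computable_rec (G := fun _ r _ => r.+1) cG cF _).
  by move=> x; elim: (G x) => /= [|n ->]; rewrite ?addn0 ?addnS.
by apply: computable_succ; base.
Qed.

Lemma computable_sub (E : Type) (ctx : seq (E -> nat)) (F G : E -> nat) :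
  computable ctx F -> computable ctx G -> computable ctx (fun x => F x - G x).
Proof.
move=> cF cG.
apply: eq_computable (computable_rec (G := fun _ r _ => r.-1) cG cF _).
  by move=> x; elim: (G x) => /= [|n ->]; rewrite ?subn0 ?subnS.
by apply: computable_pred; base.
Qed.

Lemma computable_mul (E : Type) (ctx : seq (E -> nat)) (F G : E -> nat) :
  computable ctx F -> computable ctx G -> computable ctx (fun x => F x * G x).
Proof.
move=> cF cG.
apply: eq_computable (computable_rec (F := fun=> 0)
  (G := fun _ r x => r + F x) cG _ _); try base.
  by move=> x; elim: (G x) => /= [|n ->]; rewrite ?muln0 ?mulnSr.
by apply: computable_add; base.
Qed.

Lemma computable_double (E : Type) (ctx : seq (E -> nat)) (F : E -> nat) :
  computable ctx F -> computable ctx (fun x => (F x).*2).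
Proof.
move=> cF; apply: (eq_computable (F := fun x => F x + F x)).
  by move=> x; rewrite addnn.
exact: computable_add.
Qed.

Lemma computable_exp2 (E : Type) (ctx : seq (E -> nat)) (F : E -> nat) :
  computable ctx F -> computable ctx (fun x => 2 ^ F x).
Proof.
move=> cF; apply: eq_computable (computable_rec (F := fun=> 1)
  (G := fun _ r _ => r.*2) cF _ _); try base.
  by move=> x; elim: (F x) => //= n ->; rewrite expnS mul2n.
by apply: computable_double; base.
Qed.

Lemma computable_eq0 (E : Type) (ctx : seq (E -> nat)) (F : E -> nat) :
  computable ctx F -> computable ctx (fun x => F x == 0).
Proof.
move=> cF; apply: (eq_computable (F := fun x => 1 - F x)).
  by move=> x; case: (F x).
by apply: computable_sub; base.
Qed.

Lemma computable_neg (E : Type) (ctx : seq (E -> nat)) (b : E -> bool) :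
  computable ctx b -> computable ctx (fun x => ~~ b x).
Proof.
move=> cb; apply: (eq_computable (F := fun x => b x == 0 :> nat)).
  by move=> x; case: (b x).
exact: computable_eq0.
Qed.

Lemma computable_leq (E : Type) (ctx : seq (E -> nat)) (F G : E -> nat) :
  computable ctx F -> computable ctx G -> computable ctx (fun x => F x <= G x).
Proof. by move=> cF cG; apply/computable_eq0/computable_sub. Qed.

Lemma computable_eq (E : Type) (ctx : seq (E -> nat)) (F G : E -> nat) :
  computable ctx F -> computable ctx G -> computable ctx (fun x => F x == G x).
Proof.
move=> cF cG.
apply: (eq_computable (F := fun x => (F x <= G x) * (G x <= F x))).
  by move=> x; rewrite mulnb -eqn_leq.
by apply: computable_mul; apply: computable_leq.
Qed.

Lemma computable_if (E : Type) (ctx : seq (E -> nat)) (b : E -> bool)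
    (F G : E -> nat) :
  computable ctx b -> computable ctx F -> computable ctx G ->
  computable ctx (fun x => if b x then F x else G x).
Proof.
move=> cb cF cG.
apply: (eq_computable (F := fun x => b x * F x + ~~ b x * G x)).
  by move=> x; case: (b x); rewrite !(mul0n, mul1n) ?addn0.
by apply: computable_add; apply: computable_mul; rewrite //; apply: computable_neg.
Qed.

Lemma computable_odd (E : Type) (ctx : seq (E -> nat)) (F : E -> nat) :
  computable ctx F -> computable ctx (fun x => odd (F x)).
Proof.
move=> cF; apply: eq_computable (computable_rec (F := fun=> 0)
  (G := fun _ r _ => r == 0) cF _ _); try base.
  by move=> x; elim: (F x) => //= n ->; case: odd.
by apply: computable_eq0; base.
Qed.

Lemma computable_half (E : Type) (ctx : seq (E -> nat)) (F : E -> nat) :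
  computable ctx F -> computable ctx (fun x => (F x)./2).
Proof.
move=> cF; apply: eq_computable (computable_rec (F := fun=> 0)
  (G := fun m r _ => r + odd m) cF _ _); try base.
  by move=> x; elim: (F x) => //= n ->; rewrite uphalf_half addnC.
by apply: computable_add; [base | apply: computable_odd; base].
Qed.


(** * Iterated operations *)

(** The recursion carries the code of the partial result. Since [enc] is a bijection, the
    accumulator [r] is itself the code of [dec r], so [op] applies to it directly. *)
Lemma computable_big (T : Type) (enc : T -> nat) (dec : nat -> T) (idx : T)
    (op : Monoid.law idx) :
  cancel enc dec -> cancel dec enc ->
  (forall (E : Type) (ctx : seq (E -> nat)) (F G : E -> T),
    computable ctx (fun x => enc (F x)) -> computable ctx (fun x => enc (G x)) ->
    computable ctx (fun x => enc (op (F x) (G x)))) ->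
  forall (E : Type) (ctx : seq (E -> nat)) (N : E -> nat) (F : nat -> E -> T),
    computable ctx N -> computable (bind ctx) (fun p => enc (F p.1 p.2)) ->
    computable ctx (fun x => enc (\big[op/idx]_(0 <= i < N x) F i x)).
Proof.
move=> encK decK cop E ctx N F cN cF.
apply: eq_computable (computable_rec (F := fun=> enc idx)
  (G := fun m r x => enc (op (dec r) (F m x))) cN _ _); try base.
  move=> x; elim: (N x) => /= [|n ->]; first by rewrite big_geq.
  by rewrite big_nat_recr //= encK.
apply: cop; last exact: computable_weaken_under cF.
by apply: (eq_computable (F := fun p => p.2.1)) => [p /=|]; [rewrite decK | base].
Qed.

Lemma computable_sum (E : Type) (ctx : seq (E -> nat)) (N : E -> nat)
    (F : nat -> E -> nat) :
  computable ctx N -> computable (bind ctx) (fun p => F p.1 p.2) ->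
  computable ctx (fun x => \sum_(0 <= i < N x) F i x).
Proof.
apply: (@computable_big nat id id 0 addn) => // E' ctx' G H.
exact: computable_add.
Qed.

Lemma computable_iter (f : nat -> nat) :
  (forall (E : Type) (ctx : seq (E -> nat)) (F : E -> nat),
    computable ctx F -> computable ctx (fun x => f (F x))) ->
  forall (E : Type) (ctx : seq (E -> nat)) (N F : E -> nat),
    computable ctx N -> computable ctx F ->
    computable ctx (fun x => iter (N x) f (F x)).
Proof.
move=> cf E ctx N F cN cF.
apply: eq_computable (computable_rec (G := fun _ r _ => f r) cN cF _).
  by move=> x; elim: (N x) => //= n ->.
by apply: cf; base.
Qed.

(** * Reading and building codes of sequences *)

(* [CodeSeq.code (x :: s)] is 2 ^ x times the odd number 2 * code s + 1.       *)
Definition strip (c : nat) : nat := if odd c then c else c./2.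

(** The 2-adic valuation of [c]: the number of halvings before an odd number appears. The bound [c]
    suffices because [x < CodeSeq.code (x :: s)]; for [c = 0] the sum is empty, in agreement with
    the default head 0. *)
Definition car (c : nat) : nat := \sum_(0 <= i < c) ~~ odd (iter i strip c).

(** On the code of [x :: s], stripping leaves the odd part [2 * code s + 1], and halving drops its
    last bit. *)
Definition cdr (c : nat) : nat := (iter c strip c)./2.

Lemma iter_strip_le (i n m : nat) :
  i <= n -> iter i strip (2 ^ n * m) = 2 ^ (n - i) * m.
Proof.
elim: i => [|i IH] lin; first by rewrite subn0.
rewrite /= IH ?(ltnW lin) // subnS /strip; case: (n - i) (subn_gt0 i n) => [|k _].
  by rewrite lin.
by rewrite expnS -mulnA mul2n odd_double doubleK.
Qed.

Lemma iter_strip_odd (i m : nat) : odd m -> iter i strip m = m.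
Proof. by move=> om; elim: i => //= i ->; rewrite /strip om. Qed.

Lemma iter_strip_ge (i n m : nat) :
  n <= i -> odd m -> iter i strip (2 ^ n * m) = m.
Proof.
move=> lni om; rewrite -(subnK lni) iterD iter_strip_le // subnn mul1n.
exact: iter_strip_odd.
Qed.

Lemma code_cons_gt (x : nat) (s : seq nat) : x < CodeSeq.code (x :: s).
Proof. by have /allP -> := CodeSeq.ltn_code (x :: s); rewrite ?mem_head. Qed.

Lemma car_code (s : seq nat) : car (CodeSeq.code s) = head 0 s.
Proof.
case: s => [|x s]; first by rewrite /car big_geq.
have ltx := code_cons_gt x s.
(* The first [x] iterates are even and count 1 each; from index [x] on, the iterates equal the odd
   part and count 0. *)
rewrite /car (big_cat_nat (n := x)) ?(ltnW ltx) //=.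
rewrite (eq_big_nat _ _ (F2 := fun=> 1)) => [|i /andP[_ lix]]; last first.
  rewrite iter_strip_le ?(ltnW lix) // oddM oddX.
  by move: lix; rewrite -subn_gt0; case: (x - i).
rewrite sum_nat_const_nat subn0 muln1 big1_seq ?addn0 // => i.
rewrite mem_index_iota => /andP[_ /andP[lxi _]].
by rewrite iter_strip_ge //= odd_double.
Qed.

Lemma cdr_code (s : seq nat) : cdr (CodeSeq.code s) = CodeSeq.code (behead s).
Proof.
case: s => // x s; rewrite /cdr [X in iter _ _ X]/= iter_strip_ge.
- by rewrite /= uphalf_double.
- by rewrite ltnW ?code_cons_gt.
- by rewrite /= odd_double.
Qed.

Lemma iter_cdr_code (i : nat) (s : seq nat) :
  iter i cdr (CodeSeq.code s) = CodeSeq.code (drop i s).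
Proof.
elim: i => [|i IH]; first by rewrite drop0.
by rewrite iterS IH cdr_code -drop1 drop_drop add1n.
Qed.

Definition item (c i : nat) : nat := nth 0 (CodeSeq.decode c) i.

Lemma item_code (s : seq nat) (i : nat) : item (CodeSeq.code s) i = nth 0 s i.
Proof. by rewrite /item CodeSeq.codeK. Qed.

Definition len (c : nat) : nat := size (CodeSeq.decode c).

Lemma itemE (c i : nat) : item c i = car (iter i cdr c).
Proof.
rewrite /item -{2}(CodeSeq.decodeK c) iter_cdr_code car_code.
by rewrite -nth0 nth_drop addn0.
Qed.

Lemma size_code (s : seq nat) : size s <= CodeSeq.code s.
Proof.
elim: s => //= x s IH; apply: leq_trans (leq_pmull _ _); last by rewrite expn_gt0.
by rewrite ltnS -addnn (leq_trans IH) ?leq_addr.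
Qed.

(** Only the empty sequence has code 0, so the sum counts the nonempty suffixes; by [size_code] the
    range is long enough. *)
Lemma lenE (c : nat) : len c = \sum_(0 <= i < c) ~~ (iter i cdr c == 0).
Proof.
rewrite /len -[in RHS](CodeSeq.decodeK c); move: (CodeSeq.decode c) => s.
rewrite (big_cat_nat (n := size s)) ?size_code //=.
rewrite (eq_big_nat _ _ (F2 := fun=> 1)) => [|i /andP[_ lis]]; last first.
  by rewrite iter_cdr_code (drop_nth 0) //= -lt0n muln_gt0 expn_gt0.
rewrite sum_nat_const_nat subn0 muln1 big1_seq ?addn0 // => i.
rewrite mem_index_iota => /andP[_ /andP[lxi _]].
by rewrite iter_cdr_code drop_oversize.
Qed.

Lemma computable_strip (E : Type) (ctx : seq (E -> nat)) (F : E -> nat) :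
  computable ctx F -> computable ctx (fun x => strip (F x)).
Proof.
move=> cF; apply: computable_if => //; first exact: computable_odd.
exact: computable_half.
Qed.

Lemma computable_car (E : Type) (ctx : seq (E -> nat)) (F : E -> nat) :
  computable ctx F -> computable ctx (fun x => car (F x)).
Proof.
move=> cF; apply: (computable_sum (F := fun i x => ~~ odd (iter i strip (F x)))) => //.
by apply/computable_neg/computable_odd/computable_iter; [exact: computable_strip|base..].
Qed.

Lemma computable_cdr (E : Type) (ctx : seq (E -> nat)) (F : E -> nat) :
  computable ctx F -> computable ctx (fun x => cdr (F x)).
Proof. by move=> cF; apply/computable_half/computable_iter => //; exact: computable_strip. Qed.

Lemma computable_item (E : Type) (ctx : seq (E -> nat)) (C I : E -> nat) :
  computable ctx C -> computable ctx I ->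
  computable ctx (fun x => item (C x) (I x)).
Proof.
move=> cC cI; apply: (eq_computable (F := fun x => car (iter (I x) cdr (C x)))).
  by move=> x; rewrite itemE.
by apply/computable_car/computable_iter => //; exact: computable_cdr.
Qed.

Lemma computable_len (E : Type) (ctx : seq (E -> nat)) (C : E -> nat) :
  computable ctx C -> computable ctx (fun x => len (C x)).
Proof.
move=> cC.
apply: (eq_computable (F := fun x => \sum_(0 <= i < C x) ~~ (iter i cdr (C x) == 0))).
  by move=> x; rewrite lenE.
apply: (computable_sum (F := fun i x => ~~ (iter i cdr (C x) == 0))) => //.
by apply/computable_neg/computable_eq0/computable_iter; [exact: computable_cdr|base..].
Qed.

Lemma computable_code_cons (E : Type) (ctx : seq (E -> nat)) (F : E -> nat)
    (s : E -> seq nat) :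
  computable ctx F -> computable ctx (fun x => CodeSeq.code (s x)) ->
  computable ctx (fun x => CodeSeq.code (F x :: s x)).
Proof.
move=> cF cs; apply: computable_mul; first exact: computable_exp2.
by apply: computable_succ; apply: computable_double.
Qed.

(** A code grows by consing at the front, so the sequence is built from its last entry: after [k]
    steps the accumulator encodes the last [k] entries. *)
Lemma computable_code_mkseq (E : Type) (ctx : seq (E -> nat)) (N : E -> nat)
    (F : nat -> E -> nat) :
  computable ctx N -> computable (bind ctx) (fun p => F p.1 p.2) ->
  computable ctx (fun x => CodeSeq.code (mkseq (fun i => F i x) (N x))).
Proof.
move=> cN cF; apply: eq_computable (computable_rec (F := fun=> 0)
  (G := fun m r x => 2 ^ F (N x - m.+1) x * r.*2.+1) cN _ _); try base.
  move=> x; rewrite /mkseq.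
  suff IH k : k <= N x -> nat_rect (fun=> nat) 0
      (fun m r => 2 ^ F (N x - m.+1) x * r.*2.+1) k =
      CodeSeq.code [seq F i x | i <- iota (N x - k) k].
    by rewrite IH // subnn.
  elim: k => //= k IH ltk; rewrite IH ?(ltnW ltk) //.
  by rewrite -(subSn ltk) subSS.
apply: computable_mul; last by apply/computable_succ/computable_double; base.
apply: computable_exp2.
(* The index is bound as a new variable; the two weakenings then skip the counter and the
   accumulator lying between it and [x]. *)
apply: (computable_let (M := fun p => N p.2.2 - p.1.+1) (F := fun p => F p.1 p.2.2.2)).
  by apply: computable_sub; [|apply: computable_succ]; base.
exact: computable_weaken_under (computable_weaken_under cF).
Qed.

(** * Integer arithmetic on codes *)

Definition int_of_code (n : nat) : int := if odd n then Negz n./2 else Posz n./2.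

Lemma code_intK : cancel code_int int_of_code.
Proof.
by case=> n; rewrite /int_of_code /= odd_double ?uphalf_double ?doubleK.
Qed.

Lemma int_of_codeK : cancel int_of_code code_int.
Proof.
move=> n; rewrite -[RHS]odd_double_half /int_of_code.
by case: (odd n).
Qed.

(** Positive and negative parts of the integer with code [n]; an odd code [2k + 1] stands for
    [-(k + 1)]. *)
Definition pos_part (n : nat) : nat := if odd n then 0 else n./2.
Definition neg_part (n : nat) : nat := if odd n then n./2.+1 else 0.

Definition code_diff (p q : nat) : nat :=
  if q <= p then (p - q).*2 else (q - p).-1.*2.+1.

Lemma code_diffE (p q : nat) : code_diff p q = code_int (p%:Z - q%:Z)%R.
Proof.
rewrite /code_diff; case: leqP => [leqp|ltpq]; first by rewrite subzn.
rewrite -[(_ - _)%R]opprB subzn ?(ltnW ltpq) //.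
by case: (q - p) (subn_gt0 p q) => [|k]; rewrite ?ltpq // -NegzE.
Qed.

Lemma int_partsE (z : int) :
  z = ((pos_part (code_int z))%:Z - (neg_part (code_int z))%:Z)%R.
Proof.
case: z => n; rewrite /pos_part /neg_part /= odd_double /=.
  by rewrite subr0 doubleK.
by rewrite uphalf_double sub0r NegzE.
Qed.

Section Integers.
Variables (E : Type) (ctx : seq (E -> nat)).

Lemma computable_code_diff (P Q : E -> nat) :
  computable ctx P -> computable ctx Q ->
  computable ctx (fun x => code_diff (P x) (Q x)).
Proof.
move=> cP cQ; apply: computable_if; first exact: computable_leq.
  by apply/computable_double/computable_sub.
by apply/computable_succ/computable_double/computable_pred/computable_sub.
Qed.

Lemma computable_pos_part (F : E -> nat) :
  computable ctx F -> computable ctx (fun x => pos_part (F x)).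
Proof.
move=> cF; apply: computable_if; [exact: computable_odd | base |].
exact: computable_half.
Qed.

Lemma computable_neg_part (F : E -> nat) :
  computable ctx F -> computable ctx (fun x => neg_part (F x)).
Proof.
move=> cF; apply: computable_if; [exact: computable_odd | | base].
by apply/computable_succ/computable_half.
Qed.

Lemma computable_int_of_code (F : E -> nat) :
  computable ctx F -> computable ctx (fun x => code_int (int_of_code (F x))).
Proof. by apply: eq_computable => x; rewrite int_of_codeK. Qed.

(** Integers are handled as differences of naturals, so that sums and products reduce to natural
    arithmetic on the parts, followed by one [code_diff]. *)
Lemma computable_addz (F G : E -> int) :
  computable ctx (fun x => code_int (F x)) -> computable ctx (fun x => code_int (G x)) ->
  computable ctx (fun x => code_int (F x + G x)%R).
Proof.
move=> cF cG; apply: eq_computable (computable_code_diff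
  (computable_add (computable_pos_part cF) (computable_pos_part cG))
  (computable_add (computable_neg_part cF) (computable_neg_part cG))) => x /=.
rewrite code_diffE [in RHS](int_partsE (F x)) [in RHS](int_partsE (G x)) !PoszD.
by rewrite opprD addrACA.
Qed.

Lemma computable_mulz (F G : E -> int) :
  computable ctx (fun x => code_int (F x)) -> computable ctx (fun x => code_int (G x)) ->
  computable ctx (fun x => code_int (F x * G x)%R).
Proof.
move=> cF cG; have [pF nF] := (computable_pos_part cF, computable_neg_part cF).
have [pG nG] := (computable_pos_part cG, computable_neg_part cG).
apply: eq_computable (computable_code_diff
  (computable_add (computable_mul pF pG) (computable_mul nF nG))
  (computable_add (computable_mul pF nG) (computable_mul nF pG))) => x /=.
rewrite code_diffE [in RHS](int_partsE (F x)) [in RHS](int_partsE (G x)).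
by rewrite !PoszD !PoszM mulrBl !mulrBr opprB opprD addrACA.
Qed.

End Integers.

Lemma computable_sumz (E : Type) (ctx : seq (E -> nat)) (N : E -> nat)
    (F : nat -> E -> int) :
  computable ctx N -> computable (bind ctx) (fun p => code_int (F p.1 p.2)) ->
  computable ctx (fun x => code_int (\sum_(0 <= i < N x) F i x)%R).
Proof.
apply: (computable_big (op := +%R) code_intK int_of_codeK) => E' ctx' G H.
exact: computable_addz.
Qed.

Lemma computable_prodz (E : Type) (ctx : seq (E -> nat)) (N : E -> nat)
    (F : nat -> E -> int) :
  computable ctx N -> computable (bind ctx) (fun p => code_int (F p.1 p.2)) ->
  computable ctx (fun x => code_int (\prod_(0 <= i < N x) F i x)%R).
Proof.
apply: (computable_big (op := *%R) code_intK int_of_codeK) => E' ctx' G H.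
exact: computable_mulz.
Qed.

Lemma computable_ifz (E : Type) (ctx : seq (E -> nat)) (b : E -> bool)
    (F G : E -> int) :
  computable ctx b -> computable ctx (fun x => code_int (F x)) ->
  computable ctx (fun x => code_int (G x)) ->
  computable ctx (fun x => code_int (if b x then F x else G x)).
Proof.
move=> cb cF cG; apply: eq_computable (computable_if cb cF cG) => x /=.
by case: (b x).
Qed.

(** * Squaring a loop at the level of codes *)

Local Open Scope ring_scope.

Ltac compute_step :=
  first
  [ base
  | lazymatch goal with
    | |- computable _ (fun x => CodeSeq.code (mkseq (@?F x) _)) =>
        apply: computable_code_mkseq
    | |- computable _ (fun x => CodeSeq.code (_ :: _)) =>
        apply: computable_code_cons
    | |- computable _ (fun x => code_int (\sum_(0 <= i < _) _)) =>
        apply: computable_sumz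
    | |- computable _ (fun x => code_int (\prod_(0 <= i < _) _)) =>
        apply: computable_prodz
    | |- computable _ (fun x => code_int (_ + _)) => apply: computable_addz
    | |- computable _ (fun x => code_int (_ * _)) => apply: computable_mulz
    | |- computable _ (fun x => code_int (if _ then _ else _)) =>
        apply: computable_ifz
    | |- computable _ (fun x => code_int (int_of_code _)) =>
        apply: computable_int_of_code
    | |- computable _ (fun x => item _ _) => apply: computable_item
    | |- computable _ (fun x => len _) => apply: computable_len
    | |- computable _ (fun x => if _ then _ else _) => apply: computable_if
    | |- computable _ (fun x => (_ + _)%N) => apply: computable_add
    | |- computable _ (fun x => (_ - _)%N) => apply: computable_sub
    | |- computable _ (fun x => nat_of_bool (_ <= _)%N) => apply: computable_leq
    | |- computable _ (fun x => nat_of_bool (_ == _)) => apply: computable_eq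
    end ].

(* Accessors for the code [l] of a loop and the code [a] of an expression.     *)
Definition matrix_of (l : nat) (i j : nat) : int :=
  int_of_code (item (item (item l 2) i) j).
Definition offset_of (l : nat) (i : nat) : int :=
  int_of_code (item (item l 3) i).
Definition num_of (a k : nat) : int := int_of_code (item (item (item a 0) k) 0).
Definition den_of (a k : nat) : int := int_of_code (item (item (item a 0) k) 1).
Definition cst_num_of (a : nat) : int := int_of_code (item (item a 1) 0).
Definition cst_den_of (a : nat) : int := int_of_code (item (item a 1) 1).

(** The [k]-th coefficient times the common denominator: its own denominator is left out of the
    product, which avoids a division. *)
Definition scaled_coef (d a k : nat) : int :=
  num_of a k * (\prod_(0 <= l < d) if l == k then 1 else den_of a l) *
  cst_den_of a.

Definition scaled_cst (d a : nat) : int :=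
  cst_num_of a * \prod_(0 <= l < d) den_of a l.

(** The code of [z] as a rational: its denominator 1 has code 2. *)
Definition code_intrat (z : int) : nat := CodeSeq.code [:: code_int z; 2].

Definition code_pull_expr (l d a : nat) : nat :=
  CodeSeq.code
    [:: CodeSeq.code (mkseq (fun j => code_intrat
          (\sum_(0 <= k < d) scaled_coef d a k * matrix_of l k j)) d);
        code_intrat
          (\sum_(0 <= k < d) scaled_coef d a k * offset_of l k + scaled_cst d a)].

Definition code_square (l : nat) : nat :=
  CodeSeq.code
    [:: item l 0;
        CodeSeq.code (mkseq (fun i =>
          (* The old atoms come first, followed by their pulled-back versions in the same order, as
             in the guard of [square]. *)
          if (len (item l 1) <= i)%N
          then code_pull_expr l (item l 0) (item (item l 1) (i - len (item l 1)))
          else item (item l 1) i) (len (item l 1) + len (item l 1)));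
        CodeSeq.code (mkseq (fun i => CodeSeq.code (mkseq (fun j => code_int
          (\sum_(0 <= k < item l 0) matrix_of l i k * matrix_of l k j))
          (item l 0))) (item l 0));
        CodeSeq.code (mkseq (fun i => code_int
          (\sum_(0 <= k < item l 0) matrix_of l i k * offset_of l k +
             offset_of l i)) (item l 0))].

Lemma computable_code_square : computable [:: id] code_square.
Proof.
rewrite /code_square /code_pull_expr /scaled_coef /scaled_cst /code_intrat.
rewrite /matrix_of /offset_of /num_of /den_of /cst_num_of /cst_den_of.
by repeat compute_step.
Qed.

Lemma item_code_vec (n : nat) (f : 'I_n -> nat) (i : 'I_n) :
  item (code_vec f) i = f i.
Proof. by rewrite item_code (nth_map i) ?size_enum_ord // nth_ord_enum. Qed.

Lemma code_vec_mkseq (n : nat) (f : 'I_n -> nat) (F : nat -> nat) :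
  (forall i : 'I_n, f i = F i) -> code_vec f = CodeSeq.code (mkseq F n).
Proof.
move=> fF; rewrite /code_vec /mkseq -val_enum_ord -map_comp.
by congr CodeSeq.code; apply: eq_map => i /=.
Qed.

Lemma code_rat_int (z : int) : code_rat z%:~R = code_intrat z.
Proof. by rewrite /code_rat numq_int denq_int. Qed.

(** * The squared loop: termination and non-negative diagonal *)

(* Clearing denominators makes the coefficients of [pull_expr] integers, whose *)
(* codes need no reduction to lowest terms.                                    *)
Definition common_den (d : nat) (alpha : affine_expr d) : int :=
  (\prod_j denq (alpha.1 0 j)) * denq alpha.2.

Definition pull_expr (L : affine_loop) (alpha : affine_expr (dim L)) :
    affine_expr (dim L) :=
  let D := (common_den alpha)%:~R in
  (D *: (alpha.1 *m map_mx intr (update_mx L)),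
   D * affine_val alpha (update_cst L)).

Definition square (L : affine_loop) : affine_loop :=
  AffineLoop (dim_gt0 L) (guard L ++ [seq pull_expr alpha | alpha <- guard L])
    (update_mx L *m update_mx L)
    (update_mx L *m update_cst L + update_cst L).

Lemma common_den_gt0 (d : nat) (alpha : affine_expr d) : 0 < common_den alpha.
Proof. by rewrite mulr_gt0 ?denq_gt0 ?prodr_gt0 // => j _; exact: denq_gt0. Qed.

Lemma affine_val_pull (L : affine_loop) (alpha : affine_expr (dim L))
    (c : 'cV[int]_(dim L)) :
  affine_val (pull_expr alpha) c =
  (common_den alpha)%:~R * affine_val alpha (update c).
Proof.
rewrite /affine_val /pull_expr /update /= /affine_val -scalemxAl mxE -mulrDr.
by rewrite map_mxD map_mxM mulmxDr mulmxA [in RHS]mxE addrA.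
Qed.

Lemma update_square (L : affine_loop) (x : 'cV[int]_(dim L)) :
  @update (square L) x = update (update x).
Proof. by rewrite /update /= mulmxDr mulmxA addrA. Qed.

Lemma guard_square (L : affine_loop) (x : 'cV[int]_(dim L)) :
  @guard_holds (square L) x = guard_holds x && guard_holds (update x).
Proof.
rewrite /guard_holds all_cat all_map; congr (_ && _).
apply: eq_all => alpha /=.
by rewrite affine_val_pull pmulr_rgt0 // ltr0z common_den_gt0.
Qed.

Lemma nonterminating_square (L : affine_loop) :
  nonterminating (square L) <-> nonterminating L.
Proof.
have iter2 (c : 'cV[int]_(dim L)) n :
    iter n (@update (square L)) c = iter n.*2 (@update L) c.
  by elim: n => //= n ->; rewrite update_square.
split=> -[c cP]; exists c => n; last first.
  by rewrite guard_square iter2 cP /= -iterS cP.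
(* Iteration [n./2] of the squared loop tests the states of index [n./2.*2] and its successor, and
   [n] is one of these according to its parity. *)
have := cP n./2; rewrite guard_square iter2 -iterS => /andP[].
by move: (n./2) (odd_double_half n) => m; case: (odd n) => /= <-.
Qed.

(** For [i < j] every [k] satisfies [i < k] or [k < j], so each product [A i k * B k j] has a zero
    factor. *)
Lemma mulmx_trig (R : nzRingType) (n : nat) (A B : 'M[R]_n) :
  is_trig_mx A -> is_trig_mx B -> is_trig_mx (A *m B).
Proof.
move=> /is_trig_mxP At /is_trig_mxP Bt; apply/is_trig_mxP => i j ltij.
rewrite mxE big1 // => k _; have [ltik|leki] := ltnP i k.
  by rewrite At ?mul0r.
by rewrite Bt ?mulr0 ?(leq_ltn_trans leki).
Qed.

Lemma mulmx_trig_diag (R : nzRingType) (n : nat) (A B : 'M[R]_n) (i : 'I_n) :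
  is_trig_mx A -> is_trig_mx B -> (A *m B) i i = A i i * B i i.
Proof.
move=> /is_trig_mxP At /is_trig_mxP Bt.
rewrite mxE (bigD1 i) //= big1 ?addr0 // => k neki.
have [ltik|ltki|/ord_inj eqik] := ltngtP i k; first by rewrite At ?mul0r.
  by rewrite Bt ?mulr0.
by rewrite eqik eqxx in neki.
Qed.

(** The upper triangular case reduces to the lower one by transposition, which preserves the
    diagonal and turns the square of [A] into the square of its transpose. *)
Lemma nnt_square (L : affine_loop) : triangular L -> nnt (square L).
Proof.
case=> At; split.
- by left; exact: mulmx_trig.
- by move=> i /=; rewrite mulmx_trig_diag // -expr2 sqr_ge0.
- by right; rewrite /= trmx_mul mulmx_trig.
- move=> i; have -> : update_mx (square L) i i = (update_mx (square L))^T i i.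
    by rewrite [RHS]mxE.
  by rewrite /= trmx_mul mulmx_trig_diag // -expr2 sqr_ge0.
Qed.

(** * Agreement of the function on codes with the squared loop *)

Section Codes.
Variable L : affine_loop.
Let d := dim L.
Let l := code_loop L.

Lemma matrix_of_code (i j : 'I_d) : matrix_of l i j = update_mx L i j.
Proof. by rewrite /matrix_of item_code !item_code_vec code_intK. Qed.

Lemma offset_of_code (i : 'I_d) : offset_of l i = update_cst L i 0.
Proof. by rewrite /offset_of item_code item_code_vec code_intK. Qed.

Lemma num_of_code (alpha : affine_expr d) (k : 'I_d) :
  num_of (code_expr alpha) k = numq (alpha.1 0 k).
Proof. by rewrite /num_of item_code /= item_code_vec item_code code_intK. Qed.

Lemma den_of_code (alpha : affine_expr d) (k : 'I_d) :
  den_of (code_expr alpha) k = denq (alpha.1 0 k).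
Proof. by rewrite /den_of item_code /= item_code_vec item_code code_intK. Qed.

Lemma cst_num_of_code (alpha : affine_expr d) :
  cst_num_of (code_expr alpha) = numq alpha.2.
Proof. by rewrite /cst_num_of !item_code code_intK. Qed.

Lemma cst_den_of_code (alpha : affine_expr d) :
  cst_den_of (code_expr alpha) = denq alpha.2.
Proof. by rewrite /cst_den_of !item_code code_intK. Qed.

(** The factor [denq (alpha.1 0 k)] split off from [common_den alpha] turns the coefficient into its
    numerator. *)
Lemma scaled_coef_code (alpha : affine_expr d) (k : 'I_d) :
  (scaled_coef d (code_expr alpha) k)%:~R =
  (common_den alpha)%:~R * alpha.1 0 k.
Proof.
rewrite /scaled_coef num_of_code cst_den_of_code.
rewrite big_mkord (bigD1 k) //= eqxx mul1r.
rewrite /common_den [in RHS](bigD1 k) //=.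
rewrite (eq_bigr (fun j => denq (alpha.1 0 j))) => [|j nejk]; last first.
  by rewrite (inj_eq val_inj) (negPf nejk) den_of_code.
by rewrite !rmorphM /= numqE [RHS]mulrC !mulrA.
Qed.

Lemma code_pull_exprE (alpha : affine_expr d) :
  code_expr (pull_expr alpha) = code_pull_expr l d (code_expr alpha).
Proof.
rewrite [in LHS]/code_expr -/d /code_pull_expr; congr (CodeSeq.code [:: _; _]).
  apply: code_vec_mkseq => j; rewrite -code_rat_int; congr code_rat.
  rewrite !mxE mulr_sumr big_mkord rmorph_sum; apply: eq_bigr => k _.
  by rewrite [in RHS]rmorphM /= scaled_coef_code matrix_of_code mxE mulrA.
rewrite -code_rat_int; congr code_rat.
rewrite /pull_expr [LHS]/= /affine_val mulrDr [in RHS]rmorphD; congr (_ + _).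
  rewrite !mxE mulr_sumr big_mkord rmorph_sum; apply: eq_bigr => k _.
  by rewrite [in RHS]rmorphM /= scaled_coef_code offset_of_code mxE mulrA.
rewrite /scaled_cst cst_num_of_code big_mkord.
rewrite (eq_bigr (fun j => denq (alpha.1 0 j))) => [|j _]; last first.
  by rewrite den_of_code.
by rewrite /common_den !rmorphM /= numqE -mulrA mulrC (mulrC (denq _)%:~R).
Qed.

Lemma code_squareE : code_loop (square L) = code_square l.
Proof.
have l0 : item l 0 = d by rewrite item_code.
have l1 : item l 1 = CodeSeq.code [seq code_expr alpha | alpha <- guard L].
  by rewrite item_code.
have len1 : len (item l 1) = size (guard L).
  by rewrite l1 /len CodeSeq.codeK size_map.
rewrite /code_square l0 len1 l1 /code_loop; congr (CodeSeq.code [:: _; _; _; _]).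
- congr CodeSeq.code; apply: (@eq_from_nth _ 0).
    by rewrite size_mkseq !size_map size_cat size_map.
  move=> i; rewrite size_map size_cat size_map => lti.
  rewrite nth_mkseq // map_cat nth_cat !size_map item_code.
  case: ltnP => [_|leni]; first by rewrite item_code.
  have lti' : (i - size (guard L) < size (guard L))%N by rewrite ltn_subLR.
  (* The guard is nonempty here, and its first atom [a] provides the default element that [nth_map]
     requires. *)
  case: (guard L) lti' => // a s lti'.
  by rewrite !(nth_map a) ?size_map //; exact: code_pull_exprE.
- apply: code_vec_mkseq => i; apply: code_vec_mkseq => j; congr code_int.
  by rewrite mxE big_mkord; apply: eq_bigr => k _; rewrite !matrix_of_code.
- apply: code_vec_mkseq => i; congr code_int.
  rewrite !mxE big_mkord offset_of_code; congr (_ + _).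
  by apply: eq_bigr => k _; rewrite matrix_of_code offset_of_code.
Qed.
End Codes.

Theorem theorem1 : termination_decidable triangular <-> termination_decidable nnt.
Proof.
split=> -[e eP].
  by exists e => L [tL _]; exact: eP.
have [r rP] := computable_code_square.
exists (Comp e [:: r]) => L tL; have := eP _ (nnt_square tL).
rewrite code_squareE => -[e1 e0].
have [sqW sqV] := nonterminating_square L.
have er := evals_cons (rP (code_loop L)) (evals_nil _).
split=> tmL; apply: (eval_comp er).
  by apply: e1 => /sqW.
by apply: e0 => tmsq; apply: tmL => /sqV.
Qed.
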